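(* Let $k$ be a positive even integer and $a\in\mathbb{Z}/N\mathbb{Z}$. Then in $\mathcal{DZ}(N)_k$ $$\sum_{1\le r<k,\ r\text{ odd}}Z^{a,a}_{r,k-r}=\frac14\Big(2Z^{N,a}_{1,k-1}+2Z^{2a,a}_{1,k-1}-Z^a_{k}+2\delta_{a,\bar0}Z^N_{k}\Big),$$ $$\sum_{1<r<k,\ r\text{ even}}Z^{a,a}_{r,k-r}=\frac14\Big(2Z^{N,a}_{1,k-1}-2Z^{2a,a}_{1,k-1}+Z^a_{k}+2\delta_{a,\bar0}Z^N_{k}\Big).$$
   Context: $N$ is a positive integer. For $k\ge2$, the formal double zeta space $\mathcal{DZ}(N)_k$ at level $N$ is the $\mathbb{Q}$-vector space spanned by formal symbols $Z^{a,b}_{r,s}$ and $Z^a_k$ ($a,b\in\mathbb{Z}/N\mathbb{Z}$, $r,s\ge1$, $r+s=k$) modulo the relations $$Z_{r,s}^{a,b}+Z_{s,r}^{b,a}+\delta_{a,b}Z^a_k=\sum_{\substack{i+j=k\\ i,j\ge1}}\left(\binom{i-1}{r-1}Z^{a+b,b}_{i,j}+\binom{i-1}{s-1}Z^{a+b,a}_{i,j}\right)$$ for all $a,b\in\mathbb{Z}/N\mathbb{Z}$ and $r,s\ge1$ with $r+s=k$. Superscripts are residue classes modulo $N$, so a superscript $N$ denotes the class $\bar0$; $\delta$ is the Kronecker symbol and $\binom00=1$. *)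

(* Defs.v *)
From HB Require Import structures.
From mathcomp Require Import all_boot all_order all_algebra.

Set Implicit Arguments.
Unset Strict Implicit.
Unset Printing Implicit Defensive.

Import GRing.Theory.
Local Open Scope ring_scope.
Local Open Scope quotient_scope.

(* ring_quotient only equips the quotient of a module with its additive
   structure; the scaling is added here. *)
Section LmodQuotient.
Variables (R : fieldType) (V : vectType R) (W : {vspace V}).

Definition lmodquot : Type := Quotient.quot W.
HB.instance Definition _ := GRing.Zmodule.on lmodquot.

Definition lmodquot_pi (v : V) : lmodquot := \pi_(Quotient.quot W) v.

Lemma lmodquot_eqP (u v : V) :
  reflect (lmodquot_pi u = lmodquot_pi v) (u - v \in W).
Proof. by rewrite Quotient.idealrBE; apply: eqP. Qed.

Lemma lmodquot_piD : {morph lmodquot_pi : u v / u + v}.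
Proof. by move=> u v; rewrite /lmodquot_pi; apply: Quotient.pi_add. Qed.

Definition lmodquot_repr (x : lmodquot) : V := repr (x : Quotient.quot W).

Lemma lmodquot_reprK : cancel lmodquot_repr lmodquot_pi.
Proof. exact: reprK. Qed.

Definition lmodquot_scale (c : R) (x : lmodquot) : lmodquot :=
  lmodquot_pi (c *: lmodquot_repr x).

Lemma lmodquot_piZ c v : lmodquot_pi (c *: v) = lmodquot_scale c (lmodquot_pi v).
Proof.
apply/lmodquot_eqP; rewrite -scalerBr rpredZ //.
by apply/lmodquot_eqP; rewrite lmodquot_reprK.
Qed.

Lemma lmodquot_scaleA a b x :
  lmodquot_scale a (lmodquot_scale b x) = lmodquot_scale (a * b) x.
Proof.
by rewrite -[x]lmodquot_reprK -!lmodquot_piZ scalerA.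
Qed.

Lemma lmodquot_scale1 : left_id 1 lmodquot_scale.
Proof. by move=> x; rewrite -[x]lmodquot_reprK -lmodquot_piZ scale1r. Qed.

Lemma lmodquot_scaleDr : right_distributive lmodquot_scale +%R.
Proof.
move=> c x y; rewrite -[x]lmodquot_reprK -[y]lmodquot_reprK.
by rewrite -lmodquot_piD -!lmodquot_piZ -lmodquot_piD scalerDr.
Qed.

Lemma lmodquot_scaleDl x : {morph lmodquot_scale^~ x : a b / a + b}.
Proof.
move=> a b; rewrite -[x]lmodquot_reprK.
by rewrite -!lmodquot_piZ -lmodquot_piD scalerDl.
Qed.

HB.instance Definition _ := GRing.Zmodule_isLmodule.Build R lmodquot
  lmodquot_scaleA lmodquot_scale1 lmodquot_scaleDr lmodquot_scaleDl.

Lemma lmodquot_pi_is_linear : linear lmodquot_pi.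
Proof. by move=> c u v; rewrite lmodquot_piD lmodquot_piZ. Qed.

HB.instance Definition _ :=
  GRing.isLinear.Build R V lmodquot _ lmodquot_pi lmodquot_pi_is_linear.

End LmodQuotient.

(* Z/NZ for every N > 0, including N = 1 (where 'Z_N would be Z/2Z). *)
Definition residue (N : nat) := 'I_N.-1.+1.
HB.instance Definition _ N := Finite.on (residue N).
HB.instance Definition _ N := GRing.Zmodule.on (residue N).

Lemma sumv_nat_sup (K : fieldType) (vT : vectType K) (Us : nat -> {vspace vT})
    (m n i : nat) :
  (m <= i < n)%N -> (Us i <= \sum_(m <= j < n) Us j)%VS.
Proof.
move=> /andP[m_le_i i_lt_n]; rewrite big_geq_mkord.
exact: (sumv_sup (Ordinal i_lt_n)).
Qed.

Section FormalDoubleZeta.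
Variables N k : nat.

(* inl (a, b, i) stands for the symbol Z^{a,b}_{r,s} with r = i + 1 and
   s = k - r, so that i < k - 1; inr a stands for the symbol Z^a_k. *)
Definition dz_symbol : Type := residue N * residue N * 'I_k.-1 + residue N.
HB.instance Definition _ := Finite.on dz_symbol.

Definition dz_free := {ffun dz_symbol -> rat^o}.
HB.instance Definition _ := Vector.on dz_free.

(* This is 0 unless r, s >= 1 and r + s = k. *)
Definition dz_free2 (a b : residue N) (r s : nat) : dz_free :=
  [ffun g : dz_symbol =>
     (if g is inl (a', b', i) then
        ((a', b', i.+1, (k - i.+1)%N) == (a, b, r, s))%:R
      else 0) : rat^o].

Definition dz_free1 (a : residue N) : dz_free :=
  [ffun g : dz_symbol => (if g is inr a' then (a' == a)%:R else 0) : rat^o].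

Definition dz_relator (a b : residue N) (r s : nat) : dz_free :=
  dz_free2 a b r s + dz_free2 b a s r + (a == b)%:R *: dz_free1 a
  - \sum_(1 <= i < k)
      ('C(i.-1, r.-1)%:R *: dz_free2 (a + b) b i (k - i)
       + 'C(i.-1, s.-1)%:R *: dz_free2 (a + b) a i (k - i)).

Definition dz_relations : {vspace dz_free} :=
  (\sum_(a : residue N) \sum_(b : residue N) \sum_(1 <= r < k)
     <[dz_relator a b r (k - r)]>)%VS.

Definition DZ : Type := lmodquot dz_relations.
HB.instance Definition _ := GRing.Lmodule.on DZ.

Definition Z2 (a b : residue N) (r s : nat) : DZ :=
  lmodquot_pi dz_relations (dz_free2 a b r s).

Definition Z1 (a : residue N) : DZ :=
  lmodquot_pi dz_relations (dz_free1 a).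

Lemma DZ_relation (a b : residue N) (r s : nat) :
  (0 < r)%N -> (0 < s)%N -> (r + s = k)%N ->
  Z2 a b r s + Z2 b a s r + (a == b)%:R *: Z1 a
  = \sum_(1 <= i < k)
      ('C(i.-1, r.-1)%:R *: Z2 (a + b) b i (k - i)
       + 'C(i.-1, s.-1)%:R *: Z2 (a + b) a i (k - i)).
Proof.
move=> r_gt0 s_gt0 rs.
have eq_s : (k - r = s)%N by rewrite -rs addKn.
have relW : dz_relator a b r s \in dz_relations.
  rewrite memvE /dz_relations; apply: (sumv_sup a) => //.
  apply: (sumv_sup b) => //.
  have r_lt_k : (r < k)%N by rewrite -rs -[X in (X < _)%N]addn0 ltn_add2l.
  rewrite -eq_s; apply: (@sumv_nat_sup _ _ (fun i => <[dz_relator a b i (k - i)]>%VS)).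
  by rewrite r_gt0.
move: relW; rewrite /dz_relator => /lmodquot_eqP.
rewrite !linearD linearZ /= linear_sum /= => ->.
by apply: eq_bigr => i _; rewrite linearD !linearZ.
Qed.

End FormalDoubleZeta.

Arguments Z2 {N k} a b r s.
Arguments Z1 {N k} a.

(* Main.v *)
Require Import Defs.
From mathcomp Require Import all_boot all_order all_algebra.
From mathcomp Require Import zify.

Import GRing.Theory.
Local Open Scope ring_scope.

(** Let Z^{a,b}(X,Y) be the sum of the Z^{a,b}_{r,s} X^(r-1) Y^(s-1).  The
    defining relations say that Z^{a,b}(X,Y) + Z^{b,a}(Y,X) plus a diagonal term
    equals Z^{a+b,b}(X+Y,Y) + Z^{a+b,a}(X+Y,X).  For the pair (a,0) at
    (X,Y) = (1,0) this computes the sum of all Z^{a,a}_{r,k-r}; for the pair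
    (a,a) at (X,Y) = (1,-1) it computes their alternating sum. *)

(** The terms with [j > n] vanish, and the others expand (1 - 1)^n. *)
Lemma sum_signed_bin (R : pzRingType) (n m : nat) : (n < m)%N ->
  \sum_(0 <= j < m) (-1) ^+ j * 'C(n, j)%:R = (n == 0)%:R :> R.
Proof.
move=> n_lt_m; rewrite (big_cat_nat (n := n.+1)) //=.
have -> : \sum_(n.+1 <= j < m) (-1) ^+ j * 'C(n, j)%:R = 0 :> R.
  by apply: big1_seq => j; rewrite mem_index_iota => /andP[_ /andP[n_lt_j _]];
    rewrite bin_small ?mulr0.
rewrite addr0 big_mkord -expr0n -[in RHS](subrr (1 : R)) (exprBn_comm _ (commr1 1)).
by apply: eq_bigr => j _; rewrite !expr1n !mulr1 mulr_natr.
Qed.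

(** There are [k - 1] signs, an odd number: after the initial 1 they cancel in pairs. *)
Lemma sum_sign_even (R : pzRingType) (k : nat) : (0 < k)%N -> ~~ odd k ->
  \sum_(1 <= r < k) (-1) ^+ r.-1 = 1 :> R.
Proof.
move=> k_gt0 k_even; have odd_k1 : odd k.-1.
  by move: k_even; rewrite -[in odd k](prednK k_gt0) /= negbK.
rewrite -(prednK k_gt0) big_add1 /= -[k.-1]prednK ?odd_gt0 // -odd_halfK //.
elim: (k.-1)./2 => [|n IHn]; first by rewrite big_nat1.
rewrite doubleS big_nat_recr //= big_nat_recr //= IHn -addrA.
by rewrite [X in _ + (_ + X)]exprS mulN1r addrN addr0.
Qed.

Lemma sum_delta (R : pzRingType) (V : lmodType R) (k i : nat) (F : nat -> V) :
  (0 < i < k)%N -> \sum_(1 <= j < k) (j == i)%:R *: F j = F i.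
Proof.
move=> i_range; have <- : \sum_(1 <= j < k | j == i) F j = F i by rewrite big_nat1_eq i_range.
rewrite [RHS]big_mkcond /=; apply: eq_bigr => j _.
by case: eqP; rewrite ?scale1r ?scale0r.
Qed.

Lemma sum_odd_even (V : zmodType) (k : nat) (F : nat -> V) :
  \sum_(1 <= r < k | odd r) F r + \sum_(2 <= r < k | ~~ odd r) F r
  = \sum_(1 <= r < k) F r.
Proof.
rewrite [RHS](bigID odd) /=; congr (_ + _).
(* The even sum may start at 2 because 1 is odd; for [k <= 1] all ranges are empty. *)
have [k_le1 | k_gt1] := leqP k 1; last by rewrite [RHS]big_ltn_cond.
by rewrite !big_geq // (leq_trans k_le1).
Qed.

Lemma sum_odd_even_sign (R : pzRingType) (V : lmodType R) (k : nat)
    (F : nat -> V) :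
  \sum_(1 <= r < k | odd r) F r - \sum_(2 <= r < k | ~~ odd r) F r
  = \sum_(1 <= r < k) (-1) ^+ r.-1 *: F r.
Proof.
rewrite -[RHS]sum_odd_even -sumrN; congr (_ + _).
  apply: eq_bigr => -[|r] //= odd_r.
  by rewrite -signr_odd (negbTE odd_r) scale1r.
rewrite big_nat_cond [RHS]big_nat_cond.
apply: eq_bigr => -[|r] //= /andP[_]; rewrite negbK => odd_r.
by rewrite -signr_odd odd_r scaleN1r.
Qed.

(** Uses 4O = 2(O + E) + 2(O - E) and 4E = 2(O + E) - 2(O - E), where [O] and [E] will be the sums
    over odd and even indices. *)
Lemma solve_sum_diff (F : fieldType) (V : lmodType F) (O E A B c d : V) :
  4%:R != 0 :> F -> O + E = A + d -> 2%:R *: (O - E) + c = 2%:R *: B ->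
  O = 4%:R^-1 *: (2%:R *: A + 2%:R *: B - c + 2%:R *: d) /\
  E = 4%:R^-1 *: (2%:R *: A - 2%:R *: B + c + 2%:R *: d).
Proof.
move=> nz4 sumOE diffOE.
have {}diffOE : 2%:R *: B - c = 2%:R *: (O - E) by rewrite -diffOE addrK.
have {}sumOE : 2%:R *: A + 2%:R *: d = 2%:R *: (O + E).
  by rewrite sumOE scalerDr.
have four (x : V) : 4%:R *: x = 2%:R *: (x + x).
  by rewrite -mulr2n -(scaler_nat 2) scalerA -natrM.
split; apply: (scalerI nz4); rewrite scalerA divff // scale1r four.
  rewrite -[_ + _ - c]addrA diffOE addrAC sumOE -scalerDr.
  by rewrite [in RHS]addrACA subrr addr0.
rewrite -[_ - _ + c]addrA -[- _ + c]opprK opprD opprK diffOE addrAC sumOE.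
by rewrite -scalerBr opprB [in RHS]addrC addrA subrK.
Qed.

(** This is the relation for the pair (a, 0) with r = k - 1 and s = 1. The binomials C(i-1, k-2)
    keep only i = k - 1, a term that cancels against the same symbol on the left; the binomials
    C(i-1, 0) are all 1 and give the full sum. *)
Lemma sum_Z2_diag (N k : nat) (a : residue N) : (1 < k)%N ->
  \sum_(1 <= r < k) Z2 a a r (k - r)
  = Z2 0 a 1 (k - 1) + (a == 0)%:R *: Z1 0 :> DZ N k.
Proof.
move=> k_gt1; have k1_gt0 : (0 < k - 1)%N by rewrite subn_gt0.
have := @DZ_relation N k a 0 (k - 1) 1 k1_gt0 isT (subnK (ltnW k_gt1)).
rewrite big_split /= addr0.
have -> : \sum_(1 <= i < k) 'C(i.-1, (k - 1).-1)%:R *: Z2 a 0 i (k - i)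
    = Z2 a 0 (k - 1) 1 :> DZ N k.
  have k1_range : (0 < k - 1 < k)%N by rewrite k1_gt0 subn1 ltn_predL ltnW.
  have := sum_delta _ _ _ _ (fun i => Z2 a 0 i (k - i) : DZ N k) k1_range.
  rewrite subKn ?(ltnW k_gt1) // => <-.
  apply: eq_big_nat => i /andP[i_gt0 i_lt_k]; congr (_%:R *: _).
  have [->|i_neq] := eqVneq; first by rewrite binn.
  rewrite bin_small //; move: i_gt0 i_lt_k i_neq; lia.
have -> : \sum_(1 <= i < k) 'C(i.-1, 0)%:R *: Z2 a a i (k - i)
    = \sum_(1 <= i < k) Z2 a a i (k - i) :> DZ N k.
  by apply: eq_bigr => i _; rewrite bin0 scale1r.
rewrite -addrA => /addrI <-; congr (_ + _).
(* The relation produces [Z1 a], which may be written [Z1 0] since its coefficient vanishes unless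
   [a = 0]. *)
by case: eqP => [->|]; rewrite ?scale0r.
Qed.

(** Take the alternating sum over r of the relations for the pair (a, a). The two halves of each
    side agree under r -> k - r, whence the factors 2. *)
Lemma sum_Z2_diag_alt (N k : nat) (a : residue N) : (0 < k)%N -> ~~ odd k ->
  2%:R *: (\sum_(1 <= r < k) (-1) ^+ r.-1 *: Z2 a a r (k - r)) + Z1 a
  = 2%:R *: Z2 (a + a) a 1 (k - 1) :> DZ N k.
Proof.
move=> k_gt0 k_even.
have k_gt1 : (1 < k)%N by case: k k_gt0 k_even => [|[]].
(* As [k] is even, r and k - r have the same parity, so reflection preserves the signs. *)
have reflect_alt (W : lmodType rat) (F : nat -> W) :
    \sum_(1 <= r < k) (-1) ^+ r.-1 *: F (k - r)%N
    = \sum_(1 <= r < k) (-1) ^+ r.-1 *: F r.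
  rewrite [RHS]big_nat_rev /=; apply: eq_big_nat => r /andP[r_gt0 r_lt_k].
  rewrite add1n subSS; congr (_ *: _).
  rewrite -[LHS]signr_odd -[RHS]signr_odd; congr (_ ^+ nat_of_bool _).
  by move: r_gt0 r_lt_k k_even; lia.
(* Here X + Y = 0 enters: among the powers (X + Y)^(i-1) only i = 1 survives. *)
have alt_bin i : (0 < i < k)%N ->
    \sum_(1 <= r < k) (-1) ^+ r.-1 *: 'C(i.-1, r.-1)%:R = (i == 1%N)%:R :> rat^o.
  move=> /andP[i_gt0 i_lt_k]; rewrite -(prednK k_gt0) big_add1 /=.
  by rewrite sum_signed_bin -?(eqn_add2r 1 i.-1) ?addn1 ?prednK // -ltnS !prednK.
have alt_rhs : \sum_(1 <= r < k) (-1) ^+ r.-1 *: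
      (\sum_(1 <= i < k) 'C(i.-1, r.-1)%:R *: Z2 (a + a) a i (k - i))
    = Z2 (a + a) a 1 (k - 1) :> DZ N k.
  under eq_bigr do rewrite scaler_sumr.
  rewrite exchange_big /=.
  rewrite -(@sum_delta rat _ k 1 (fun i => Z2 (a + a) a i (k - i))) //.
  apply: eq_big_nat => i i_range; rewrite -alt_bin // scaler_suml.
  by apply: eq_bigr => r _; rewrite scalerA.
have rel r : (0 < r < k)%N ->
    (-1) ^+ r.-1 *: (Z2 a a r (k - r) + Z2 a a (k - r) r + Z1 a)
    = (-1) ^+ r.-1 *: (\sum_(1 <= i < k)
        ('C(i.-1, r.-1)%:R *: Z2 (a + a) a i (k - i)
         + 'C(i.-1, (k - r).-1)%:R *: Z2 (a + a) a i (k - i))) :> DZ N k.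
  move=> /andP[r_gt0 r_lt_k]; rewrite -DZ_relation ?subn_gt0 //.
    by rewrite eqxx scale1r.
  by rewrite subnKC // ltnW.
have := eq_big_nat 0 +%R rel.
under eq_bigr do rewrite 2!scalerDr.
under [in RHS]eq_bigr do rewrite big_split scalerDr /=.
rewrite !big_split /= -scaler_suml sum_sign_even // scale1r alt_rhs.
(* The half with C(i-1, s-1), s = k - r, is the reflection of the one already evaluated in
   [alt_rhs]. *)
have := reflect_alt _ (fun r => \sum_(1 <= i < k)
  'C(i.-1, r.-1)%:R *: Z2 (a + a) a i (k - i) : DZ N k).
rewrite alt_rhs => -> .
have -> : \sum_(1 <= r < k) (-1) ^+ r.-1 *: Z2 a a (k - r) r
   = \sum_(1 <= r < k) (-1) ^+ r.-1 *: Z2 a a r (k - r) :> DZ N k.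
  rewrite -reflect_alt; apply: eq_big_nat => r /andP[_ r_lt_k].
  by rewrite subKn // ltnW.
by rewrite !scaler_nat !mulr2n.
Qed.

Theorem theorem3p3 (N k : nat) (N_gt0 : (0 < N)%N) (k_gt0 : (0 < k)%N)
    (k_even : ~~ odd k) (a : residue N) :
  (\sum_(1 <= r < k | odd r) Z2 a a r (k - r) : DZ N k)
    = 4%:R^-1 *: (2%:R *: Z2 0 a 1 (k - 1) + 2%:R *: Z2 (a + a) a 1 (k - 1)
                  - Z1 a + (2%:R * (a == 0)%:R) *: Z1 0)
  /\
  (\sum_(2 <= r < k | ~~ odd r) Z2 a a r (k - r) : DZ N k)
    = 4%:R^-1 *: (2%:R *: Z2 0 a 1 (k - 1) - 2%:R *: Z2 (a + a) a 1 (k - 1)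
                  + Z1 a + (2%:R * (a == 0)%:R) *: Z1 0).
Proof.
have k_gt1 : (1 < k)%N by case: k k_gt0 k_even => [|[]].
(* Splitting the scalar exposes [d] as [(a == 0)%:R *: Z1 0]. *)
rewrite -scalerA; apply: solve_sum_diff => //.
  by rewrite sum_odd_even sum_Z2_diag.
by rewrite sum_odd_even_sign sum_Z2_diag_alt.
Qed.
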